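(* Every finitely generated nilpotent group $\Gamma$ admits a $\mathcal Z$-structure $(\overline X,Z)$ with $Z$ homeomorphic to a sphere $\mathbb S^k$ for some $k\ge -1$ (where $\mathbb S^{-1}=\emptyset$).
   Context: ARs are locally compact separable metrizable contractible ANRs. An action is proper if for every compact $K$, $\{g: gK\cap K\ne\emptyset\}$ is finite, and cocompact if the quotient is compact. A closed $Z\subseteq Y$ is a $\mathcal Z$-set if there is a homotopy $\alpha:Y\times[0,1]\to Y$ with $\alpha_0=\mathrm{id}$ and $\alpha_t(Y)\subseteq Y\setminus Z$ for $t>0$. A family $\mathcal A$ of subsets of a compact space $Y$ is null if for every open cover $\mathcal U$ of $Y$ all but finitely many members of $\mathcal A$ lie in a single element of $\mathcal U$. A $\mathcal Z$-structure on $G$ is a pair $(\overline X,Z)$ with $\overline X$ a compact AR, $Z$ a $\mathcal Z$-set in $\overline X$, $X=\overline X\setminus Z$ carrying a proper cocompact $G$-action, and $\{gK:g\in G\}$ a null family in $\overline X$ for every compact $K\subseteq X$. *)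

(* Defs.v *)
From HB Require Import structures.
From mathcomp Require Import all_boot all_order all_algebra.
From mathcomp Require Import all_classical all_reals.
From mathcomp Require Import topology normedtype.
From mathcomp Require Import Rstruct Rstruct_topology.
From mathcomp Require Import monoid.

Set Implicit Arguments.
Unset Strict Implicit.
Unset Printing Implicit Defensive.

Import Order.TTheory GRing.Theory Num.Theory.
Local Open Scope classical_set_scope.
Local Open Scope ring_scope.

Notation RR := Rdefinitions.R.

Inductive gen_subgroup (G : groupType) (S : set G) : G -> Prop :=
  | gen_in x : S x -> gen_subgroup S x
  | gen_one : gen_subgroup S 1%g
  | gen_mul x y : gen_subgroup S x -> gen_subgroup S y -> gen_subgroup S (x * y)%g
  | gen_inv x : gen_subgroup S x -> gen_subgroup S (x^-1)%g.

Definition finitely_generated (G : groupType) : Prop :=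
  exists s : seq G, forall g : G, gen_subgroup [set x | x \in s] g.

(* lower central series: lcs 0 = G (= gamma_1), lcs (n+1) = [lcs n, G] *)
Fixpoint lcs (G : groupType) (n : nat) {struct n} : set G :=
  match n with
  | 0%N => [set: G]
  | n'.+1 => gen_subgroup [set z : G | exists x y : G, @lcs G n' x /\ z = [~ x, y]%g]
  end.

Definition nilpotent (G : groupType) : Prop :=
  exists n : nat, @lcs G n = [set 1%g].

Definition unit_interval : set RR := `[0%R, 1%R].

Definition separable_space (T : topologicalType) : Prop :=
  exists D : set T, countable D /\ closure D = [set: T].

Definition locally_compact_space (T : topologicalType) : Prop :=
  forall x : T, exists K : set T, compact K /\ nbhs x K.

Definition contractible (T : topologicalType) : Prop :=
  exists (H : T * RR -> T) (x0 : T),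
    {within [set: T] `*` unit_interval, continuous H} /\
    (forall x, H (x, 0%R) = x) /\ (forall x, H (x, 1%R) = x0).

Definition closed_embedding (X Y : topologicalType) (h : X -> Y) : Prop :=
  continuous h /\ injective h /\ closed (range h) /\
  exists g : Y -> X, {within range h, continuous g} /\ (forall x, g (h x) = x).

(* ANR (in the class of metrizable spaces): whenever X is a closed subset of a
   metrizable space Y, it is a retract of a neighborhood of itself in Y.
   The retraction U -> h(X) is h \o r with r : Y -> X, r \o h = id. *)
Definition ANR (X : pseudoMetricType RR) : Prop :=
  forall (Y : pseudoMetricType RR), hausdorff_space Y ->
  forall h : X -> Y, closed_embedding h ->
  exists (U : set Y) (r : Y -> X),
    open U /\ range h `<=` U /\ {within U, continuous r} /\
    (forall x, r (h x) = x).

Definition AR (X : pseudoMetricType RR) : Prop :=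
  hausdorff_space X /\ locally_compact_space X /\ separable_space X /\
  contractible X /\ ANR X.

Definition Zset (Y : topologicalType) (Z : set Y) : Prop :=
  closed Z /\
  exists alpha : Y * RR -> Y,
    {within [set: Y] `*` unit_interval, continuous alpha} /\
    (forall y, alpha (y, 0%R) = y) /\
    (forall y (t : RR), (0 < t <= 1)%R -> ~ Z (alpha (y, t))).

Definition null_family (Y : topologicalType) (A : set (set Y)) : Prop :=
  forall C : set (set Y), (forall U, C U -> open U) -> \bigcup_(U in C) U = [set: Y] ->
  finite_set [set B | A B /\ ~ (exists U, C U /\ B `<=` U)].

Definition is_action (G : groupType) (T : topologicalType) (X : set T)
  (act : G -> T -> T) : Prop :=
  (forall x, X x -> act 1%g x = x) /\
  (forall g h x, X x -> act (g * h)%g x = act g (act h x)) /\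
  (forall g x, X x -> X (act g x)) /\
  (forall g, {within X, continuous (act g)}).

Definition proper_action (G : groupType) (T : topologicalType) (X : set T)
  (act : G -> T -> T) : Prop :=
  forall K : set T, K `<=` X -> compact K ->
  finite_set [set g : G | act g @` K `&` K !=set0].

(* the quotient X/G is compact: open sets of X/G correspond to G-invariant open
   subsets of X (X is open in the ambient space, so these are open in T) *)
Definition cocompact_action (G : groupType) (T : topologicalType) (X : set T)
  (act : G -> T -> T) : Prop :=
  forall C : set (set T),
    (forall U, C U -> open U /\ U `<=` X /\ forall g, act g @` U `<=` U) ->
    X `<=` \bigcup_(U in C) U ->
    exists C' : set (set T), finite_set C' /\ C' `<=` C /\ X `<=` \bigcup_(U in C') U.

Definition Z_structure (G : groupType) (Xbar : pseudoMetricType RR) (Z : set Xbar)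
  (act : G -> Xbar -> Xbar) : Prop :=
  let X := ~` Z in
  compact [set: Xbar] /\ AR Xbar /\ Zset Z /\
  is_action X act /\ proper_action X act /\ cocompact_action X act /\
  (forall K : set Xbar, K `<=` X -> compact K ->
     null_family [set B | exists g : G, B = act g @` K]).

(* the unit sphere S^(n-1) in R^n (Euclidean norm); for n = 0 it is empty *)
Definition sphere (n : nat) : set 'rV[RR]_n :=
  [set v | (\sum_(i < n) (v ord0 i) ^+ 2)%R = 1%R].

Definition homeomorphic_sets (T1 T2 : topologicalType) (A : set T1) (B : set T2) : Prop :=
  exists (f : T1 -> T2) (g : T2 -> T1),
    {within A, continuous f} /\ {within B, continuous g} /\
    f @` A `<=` B /\ g @` B `<=` A /\
    (forall x, A x -> g (f x) = x) /\ (forall y, B y -> f (g y) = y).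

Arguments sphere n : clear implicits.
Arguments lcs G n : clear implicits.

(* Main.v *)
Require Import Defs.
From HB Require Import structures.
From mathcomp Require Import all_boot all_order all_algebra.
From mathcomp Require Import finmap.
From mathcomp Require Import all_classical all_reals.
From mathcomp Require Import topology normedtype realfun numfun.
From mathcomp Require Import Rstruct Rstruct_topology.
From mathcomp Require Import monoid.
From mathcomp Require Import zify ring lra.

(** Refine the lower central series to a chain of subgroups from [G] to [1]
whose successive quotients [N / M] are cyclic and central in [G / M].  Going
down the chain, we build actions of [G] on [R^n] that are trivial on [N],
proper modulo [N] and cocompact, and such that for every ball the quotient
[diam (g B) / |g x|] tends to [0] modulo [N].  A finite quotient [N / M] costs
nothing.  If [N / M] is infinite cyclic, the extension is described by an integer
valued cocycle on [G / N]; averaging it with a partition of unity on [R^n] gives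
a continuous cocycle [f], and [G] acts on [R^n * R] by
[(x, u) |-> (g x, u + f g x)].  The oscillation of [f g] on a ball depends only
on the class of [g] modulo [N], hence is bounded by a function of [|g x|], so
reparametrising the new coordinate by a homeomorphism [u = E t] of [R] that
grows fast enough makes this oscillation negligible.  At the end of the chain,
the radial compactification of [R^n] by a sphere is a Z-structure: a set of
diameter [e * |x|] near [x] has diameter at most [2 e] in it. *)

Set Implicit Arguments.
Unset Strict Implicit.
Unset Printing Implicit Defensive.

Import Order.TTheory GRing.Theory Num.Theory.
Import numFieldNormedType.Exports.
Local Open Scope classical_set_scope.
Local Open Scope ring_scope.

(** * Central series *)

Section Groups.
Variable G : groupType.
Implicit Types (H N M : set G).
Local Open Scope group_scope.

Definition subgroup H :=
  [/\ H 1, (forall x y, H x -> H y -> H (x * y)) & (forall x, H x -> H x^-1)].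

Lemma gen_subgroupP (S : set G) : subgroup (gen_subgroup S).
Proof. by split; [exact: gen_one|exact: gen_mul|exact: gen_inv]. Qed.

Lemma gen_subgroup_sub (S : set G) H : subgroup H -> S `<=` H ->
  gen_subgroup S `<=` H.
Proof.
move=> [H1 HM HV] SH x; elim=> {x} [x /SH//|//|x y _ Hx _ Hy|x _ Hx].
  exact: HM.
exact: HV.
Qed.

Lemma lcs_subgroup i : subgroup (lcs G i).
Proof. by case: i => [|i]; [split|exact: gen_subgroupP]. Qed.

Lemma lcs_comm i x y : lcs G i x -> lcs G i.+1 [~ x, y].
Proof. by move=> xi; apply: gen_in; exists x, y. Qed.

Lemma lcs_decr i : lcs G i.+1 `<=` lcs G i.
Proof.
elim: i => [//|i IH]; apply: gen_subgroup_sub; first exact: lcs_subgroup.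
by move=> _ [x [y [/IH xi ->]]]; exact: lcs_comm.
Qed.

Lemma commMg (x y z : G) : [~ x * y, z] = [~ x, z] * [~ [~ x, z], y] * [~ y, z].
Proof. by rewrite !commgEl !conjgE !gnorm. Qed.

Lemma commgM (x y z : G) : [~ x, y * z] = [~ x, z] * ([~ x, y] * [~ [~ x, y], z]).
Proof. by rewrite !commgEl !conjgE !gnorm. Qed.

(* Modulo the next term of the series, commutators are bimultiplicative. *)
Lemma lcs_finitely_generated i : finitely_generated G ->
  exists L : seq G, [set` L] `<=` lcs G i /\
    lcs G i `<=` gen_subgroup (lcs G i.+1 `|` [set` L]).
Proof.
move=> [S genS]; elim: i => [|i [L [Li genL]]].
  exists S; split => // x _; apply: gen_subgroup_sub (genS x).
    exact: gen_subgroupP.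
  by move=> y Sy; apply: gen_in; right.
pose L' := [seq [~ l, s] | l <- L, s <- S].
have L'i : [set` L'] `<=` lcs G i.+1.
  by move=> _ /allpairsP[[l s] [/= lL _ ->]]; apply/lcs_comm/Li.
exists L'; split => //.
set H := gen_subgroup _.
have [H1 HM HV] : subgroup H by exact: gen_subgroupP.
have Hi u y : lcs G i.+1 u -> H [~ u, y].
  by move=> ui; apply: gen_in; left; exact: lcs_comm.
have HL l y : l \in L -> H [~ l, y].
  move=> lL; have li := Li _ lL.
  apply: (@gen_subgroup_sub _ [set y | H [~ l, y]] _ _ _ (genS y)) => /=.
    split => [|a b Ha Hb|a Ha] /=; first by rewrite commg1.
      rewrite commgM; apply: (HM) => //; apply: (HM) => //.
      exact/Hi/lcs_comm.
    have /mulg1_eq/(congr1 inv) : [~ l, a^-1] * ([~ l, a] * [~ [~ l, a], a^-1]) = 1.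
      by rewrite -commgM mulgV commg1.
    rewrite invgK => ->; apply: (HV); apply: (HM) => //; exact/Hi/lcs_comm.
  by move=> s sS; apply: gen_in; right; apply: allpairs_f.
have HG x : lcs G i x -> forall y, H [~ x, y].
  move=> /genL xg.
  suff [] : lcs G i x /\ forall y, H [~ x, y] by [].
  apply: (@gen_subgroup_sub _ [set x | lcs G i x /\ forall y, H [~ x, y]] _ _ _ xg) => /=.
    have [l1 lM lV] := lcs_subgroup i.
    split => [|a b [ai Ha] [bi Hb]|a [ai Ha]] /=.
    - by split => // y; rewrite comm1g.
    - split => [|y]; first exact: lM.
      rewrite commMg; apply: (HM) => //; apply: (HM) => //; exact/Hi/lcs_comm.
    - split => [|y]; first exact: lV.
      have := commMg a a^-1 y; rewrite mulgV comm1g => /esym/mulg1_eq <-.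
      by apply: (HV); apply: (HM) => //; exact/Hi/lcs_comm.
  move=> z [zi|zL]; first by split; [exact: lcs_decr|move=> y; exact: Hi].
  by split; [exact: Li|move=> y; exact: HL].
by apply: gen_subgroup_sub => // _ [x [y [xi ->]]]; exact: HG.
Qed.

(** The commutator clause also gives normality of both subgroups, since [x ^ y = x * [~ x, y]]. *)
Definition central_step N M := [/\ subgroup N, subgroup M, M `<=` N,
  (forall x y, N x -> M [~ x, y]) &
  exists2 c, N c & N `<=` gen_subgroup (M `|` [set c])].

(** Between consecutive terms of the lower central series, the finitely many generators of the
    quotient are dropped one at a time; centrality of that quotient makes each drop a central
    step. *)
Lemma nilpotent_fg_ind (P : set G -> Prop) :
  finitely_generated G -> nilpotent G ->
  P [set: G] -> (forall N M, central_step N M -> P N -> P M) -> P [set 1].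
Proof.
move=> fgG [n <-] P0 PS; elim: n => [//|i IH].
have [L [Li genL]] := lcs_finitely_generated i fgG.
pose A (K : seq G) := gen_subgroup (lcs G i.+1 `|` [set` K]).
have lsubA K : lcs G i.+1 `<=` A K by move=> x xi; apply: gen_in; left.
have Asub K : [set` K] `<=` lcs G i -> A K `<=` lcs G i.
  move=> Ki; apply: gen_subgroup_sub; first exact: lcs_subgroup.
  by move=> x [/lcs_decr//|/Ki].
have : P (A L).
  suff -> : A L = lcs G i by [].
  by apply/seteqP; split; [exact: Asub|exact: genL].
elim: L Li {genL} => [|c K IHK] Ki PK.
  suff <- : A [::] = lcs G i.+1 by [].
  apply/seteqP; split; last exact: lsubA.
  by apply: gen_subgroup_sub; [exact: lcs_subgroup|move=> x []].
have Ki' : [set` K] `<=` lcs G i.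
  by move=> x /= xK; apply: Ki; rewrite /= inE xK orbT.
have AcA : A K `<=` A (c :: K).
  apply: gen_subgroup_sub; first exact: gen_subgroupP.
  move=> x [xi|/= xK]; first exact: lsubA.
  by apply: gen_in; right; rewrite /= inE xK orbT.
have cAc : A (c :: K) c by apply: gen_in; right; rewrite /= inE eqxx.
apply: IHK => //; apply: PS PK; split; try exact: gen_subgroupP; first exact: AcA.
  by move=> x y /(Asub _ Ki) xi; apply/lsubA/lcs_comm.
exists c => //; apply: gen_subgroup_sub; first exact: gen_subgroupP.
move=> x [xi|/=]; first by apply: gen_in; left; exact: lsubA.
rewrite inE => /predU1P[->|xK]; first by apply: gen_in; right.
by apply: gen_in; left; apply: gen_in; right.
Qed.

(** Finiteness of the image of [A] in [G / N], phrased with coset representatives so that no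
    quotient is formed; they may lie outside [A]. *)
Definition fin_mod N (A : set G) :=
  exists s : seq G, forall g, A g -> exists2 h, h \in s & N (h^-1 * g).

Definition zpow (c : G) (k : int) : G :=
  match k with Posz n => c ^+ n | Negz n => c ^- n.+1 end.

Lemma zpowS c k : zpow c (k + 1)%R = zpow c k * c.
Proof.
case: k => [n|[|n]]; first by rewrite /= addn1 expgSr.
  by rewrite /= mulVg.
rewrite (_ : (Negz n.+1 + 1)%R = Negz n); last by rewrite !NegzE; lia.
by rewrite /= [c ^+ n.+2]expgS invgM mulgVK.
Qed.

Lemma zpowB1 c k : zpow c (k - 1)%R = zpow c k * c^-1.
Proof. by apply: (@mulIg _ c); rewrite -zpowS subrK mulgVK. Qed.

Lemma zpowD c k l : zpow c (k + l)%R = zpow c k * zpow c l.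
Proof.
elim/int_ind: l => [|n IH|n IH]; first by rewrite addr0 mulg1.
  by rewrite intS addrCA addrC zpowS IH addrC zpowS mulgA.
by rewrite intS opprD addrCA addrC zpowB1 IH addrC zpowB1 mulgA.
Qed.

Lemma zpowN c k : zpow c (- k)%R = (zpow c k)^-1.
Proof. by apply/esym/mulg1_eq; rewrite -zpowD subrr. Qed.

Lemma zpow_subgroup H c k : subgroup H -> H c -> H (zpow c k).
Proof.
move=> [H1 HM HV] Hc; elim/int_ind: k => [//|n IH|n IH].
  by rewrite intS addrC zpowS; exact: HM.
by rewrite intS opprD addrC zpowB1; apply: (HM) => //; exact: HV.
Qed.

Lemma zpowM c k l : zpow c (k * l)%R = zpow (zpow c k) l.
Proof.
elim/int_ind: l => [|n IH|n IH]; first by rewrite mulr0.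
  by rewrite intS mulrDr mulr1 [in RHS]addrC zpowS -IH addrC zpowD.
by rewrite intS opprD mulrDr mulrN1 [in RHS]addrC zpowB1 -IH addrC zpowD zpowN.
Qed.

(** Every element of [N] is a power of [c] modulo [M]. If a positive power of [c] lies in [M],
    finitely many powers represent [N]; otherwise the exponent is unique and defines [chi]. *)
Lemma central_step_cyclic N M : central_step N M ->
  fin_mod M N \/ exists chi : G -> int,
    [/\ forall x y, N x -> N y -> chi (x * y) = (chi x + chi y)%R,
        forall x, N x -> chi x = 0%R <-> M x &
        forall k : int, exists2 x, N x & chi x = k].
Proof.
move=> [sN [M1 MM MV] MN NM [c Nc genc]].
have zN k : N (zpow c k) by exact: zpow_subgroup.
have Nz x : N x -> exists k, M ((zpow c k)^-1 * x).
  move=> /genc.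
  suff: gen_subgroup (M `|` [set c]) `<=` [set x | exists k, M ((zpow c k)^-1 * x)].
    by apply.
  apply: gen_subgroup_sub.
    split => [|x' y [k Mk] [l Ml]|x' [k Mk]] /=.
    - by exists 0%R; rewrite /= mulg1 invg1.
    - exists (k + l)%R; rewrite zpowD.
      (* The defect [m] is in [M]; moving it past [zpow c l] costs a commutator, again in [M]. *)
      pose m := (zpow c k)^-1 * x'.
      have -> : (zpow c k * zpow c l)^-1 * (x' * y) =
          m * [~ m, zpow c l] * ((zpow c l)^-1 * y).
        by rewrite /m !commgEl !conjgE !gnorm.
      by do 2 apply: (MM) => //; exact/NM/MN.
    - exists (- k)%R; rewrite zpowN invgK.
      pose m := (zpow c k)^-1 * x'.
      have -> : zpow c k * x'^-1 = m^-1 * [~ m^-1, zpow c (- k)].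
        by rewrite /m zpowN !commgEl !conjgE !gnorm.
      by apply: (MM); [exact: MV|exact/NM/MN/MV].
  move=> y [My|->]; first by exists 0%R; rewrite /= invg1 mul1g.
  by exists 1%R; rewrite /= mulVg.
have [[d d0 Md]|noper] := pselect (exists2 d : nat, (0 < d)%N & M (c ^+ d)).
  left; exists [seq c ^+ i | i <- iota 0 d] => g /Nz[k Mk].
  have d0' : (d%:Z != 0)%R by lia.
  exists (c ^+ `|(k %% d)%Z|%N).
    apply/mapP; exists `|(k %% d)%Z|%N => //; rewrite mem_iota /=.
    have := modz_ge0 k d0'; have := ltz_mod k d0'; lia.
  have := divz_eq k d => kE.
  have r0 := modz_ge0 k d0'.
  have -> : c ^+ `|(k %% d)%Z|%N = zpow c (k %% d)%Z by rewrite -{2}(gez0_abs r0).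
  have -> : (zpow c (k %% d)%Z)^-1 * g =
     zpow (zpow c d) (k %/ d)%Z * ((zpow c k)^-1 * g).
    have -> : zpow c k = zpow (zpow c d) (k %/ d)%Z * zpow c (k %% d)%Z.
      by rewrite -zpowM -zpowD mulrC -kE.
    have := zpowD c (d%:Z * (k %/ d)%Z) (k %% d)%Z.
    rewrite addrC zpowD zpowM => zC.
    by rewrite -zC !gnorm.
  by apply: (MM) => //; apply: zpow_subgroup.
right.
(* On [N] such an exponent exists, so the default [0] is taken only outside [N]. *)
pose chi x := xget 0%R [set k | M ((zpow c k)^-1 * x)].
have zM k : M (zpow c k) -> k = 0%R.
  move=> Mk; apply: contrapT => /eqP k0; apply: noper.
  exists `|k|%N; first by lia.
  case: k Mk k0 => n //= Mn _.
  by rewrite -[c ^+ _]invgK; exact: MV.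
have chiP x : N x -> M ((zpow c (chi x))^-1 * x).
  by move=> /Nz[k Mk]; rewrite /chi; case: xgetP => [l _ //|/(_ k)].
have chiE x k : N x -> M ((zpow c k)^-1 * x) -> chi x = k.
  move=> Nx Mk; have := MM _ _ (chiP _ Nx) (MV _ Mk).
  rewrite invgM invgK mulgA mulgK -zpowN -zpowD => /zM; lia.
have [N1 NM' NV] := sN.
exists chi; split.
- move=> x y Nx Ny; apply: chiE; first exact: NM'.
  have Mx := chiP _ Nx; have My := chiP _ Ny.
  set k := chi x in Mx *; set l := chi y in My *; rewrite zpowD.
  pose m := (zpow c k)^-1 * x.
  have -> : (zpow c k * zpow c l)^-1 * (x * y) =
      m * [~ m, zpow c l] * ((zpow c l)^-1 * y).
    by rewrite /m !commgEl !conjgE !gnorm.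
  by do 2 apply: (MM) => //; exact/NM/MN.
- move=> x Nx; split=> [x0|Mx]; first by have := chiP _ Nx; rewrite x0 invg1 mul1g.
  by apply: chiE => //; rewrite invg1 mul1g.
- by move=> k; exists (zpow c k) => //; apply: chiE => //; rewrite mulVg.
Qed.

End Groups.

(** * Controlled actions and averaged cocycles *)

(* Balls replace compact sets, so that no local compactness is needed to extend an
action from [X] to [X * R]. *)
Record controlled (R : realType) (G : groupType) (N : set G)
    (X : normedModType R) (act : G -> X -> X) : Prop := {
  ctl1 : forall x, act 1%g x = x;
  ctlM : forall g h x, act (g * h)%g x = act g (act h x);
  ctlN : forall n x, N n -> act n x = x;
  ctl_cont : forall g, continuous (act g);
  ctl_bounded : forall g r, exists s, forall x, `|x| <= r -> `|act g x| <= s;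
  ctl_proper : forall r, fin_mod N [set g | exists2 x, `|x| <= r & `|act g x| <= r];
  ctl_cocompact : exists r, forall x, exists g, `|act g x| <= r;
  ctl_small : forall r e, 0 < e -> fin_mod N [set g | exists x y,
    [/\ `|x| <= r, `|y| <= r & e * `|act g x| < `|act g x - act g y|]] }.

Lemma continuous_sum_seq (R : realType) (T : topologicalType) (I : Type)
    (s : seq I) (F : I -> T -> R) (x : T) :
  (forall i, {for x, continuous (F i)}) ->
  {for x, continuous (fun y => \sum_(i <- s) F i y)}.
Proof.
move=> cF; elim: s => [|i s IH].
  rewrite (_ : (fun _ => _) = fun=> 0); first exact: cst_continuous.
  by apply/funext => y; rewrite big_nil.
rewrite (_ : (fun _ => _) = (fun y => F i y + \sum_(i <- s) F i y)).
  by apply: cvgD; [exact: cF|exact: IH].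
by apply/funext => y; rewrite big_cons.
Qed.

Section Cocycle.
Variables (R : realType) (G : groupType) (N M : set G).
Variables (X : normedModType R) (act : G -> X -> X) (chi : G -> int).
Hypotheses (sN : subgroup N) (sub : M `<=` N).
Hypothesis comm : forall x y, N x -> M [~ x, y]%g.
Hypothesis ctl : controlled N act.
Hypothesis chiM : forall x y, N x -> N y -> chi (x * y)%g = chi x + chi y.
Hypothesis chi0 : forall x, M x -> chi x = 0.

(** Choosing from the coset [g N] as a set makes the result depend on the coset only. The set
    contains [g], so the default is never resorted to. *)
Let rep (g : G) : G := xget 1%g [set h | N (g^-1 * h)%g].

Let N1 : N 1%g. Proof. by case: sN. Qed.
Let NM x y : N x -> N y -> N (x * y)%g. Proof. by case: sN => _ + _; apply. Qed.
Let NV x : N x -> N (x^-1)%g. Proof. by case: sN => _ _; apply. Qed.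

Let repP g : N (g^-1 * rep g)%g.
Proof.
rewrite /rep; case: xgetP => [h _ //|/(_ g)]; rewrite /= mulVg => /(_ N1) [].
Qed.

Let repP' g : N ((rep g)^-1 * g)%g.
Proof. by rewrite -[X in N X]invgK invgM invgK; apply: NV; exact: repP. Qed.

Let rep_eq g h : N (g^-1 * h)%g -> rep g = rep h.
Proof.
move=> ngh; rewrite /rep; congr (xget _ _); apply/seteqP; split => k /= kN.
  have -> : (h^-1 * k = (g^-1 * h)^-1 * (g^-1 * k))%g by rewrite !gnorm.
  by apply: NM => //; exact: NV.
have -> : (g^-1 * k = (g^-1 * h) * (h^-1 * k))%g by rewrite !gnorm.
exact: NM.
Qed.

Let rep_rep g : rep (rep g) = rep g.
Proof. by apply: rep_eq; exact: repP'. Qed.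

Let repMr g h : rep (g * rep h)%g = rep (g * h)%g.
Proof. by apply: rep_eq; rewrite !gnorm. Qed.

(** Writing [g] as [rep g * n] with [n] in [N], this is [chi n]: the integer coordinate of [g] in
    its coset. *)
Let a (g : G) : int := chi ((rep g)^-1 * g)%g.

Let aM g n : N n -> a (g * n)%g = a g + chi n.
Proof.
move=> Nn; rewrite /a -(rep_eq (g := g) (h := (g * n)%g)); last first.
  by rewrite mulKg.
by rewrite mulgA chiM.
Qed.

Let Q := [set q | rep q = q].

Let d (g q : G) : int := a (g * q)%g - a q.

Let drep g q : d g (rep q) = d g q.
Proof.
have := repP' q; set n := (_ * _)%g => Nn.
have {2}-> : q = (rep q * n)%g by rewrite /n !gnorm.
by rewrite /d mulgA !(aM _ Nn); ring.
Qed.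

Let dM g h q : d (g * h)%g q = d h q + d g (rep (h * q)%g).
Proof. by rewrite drep /d mulgA; ring. Qed.

(** As [N] is central modulo [M], [n * q] is [q * n] times an element of [M], where [chi]
    vanishes. *)
Let dN n q : N n -> d n q = chi n.
Proof.
move=> Nn; have -> : d n q = a (q * (n * [~ n, q]))%g - a q.
  by rewrite /d !commgEl !conjgE !gnorm.
rewrite aM; last by apply: NM => //; apply/sub/comm.
by rewrite chiM //; [rewrite (chi0 (comm _ Nn)); lia|apply/sub/comm].
Qed.

Let r0 := proj1_sig (cid (ctl_cocompact ctl)).
Let r0P x : exists g, `|act g x| <= r0.
Proof. exact: (proj2_sig (cid (ctl_cocompact ctl))). Qed.

(** Nonzero only where [q^-1] brings [x] into the open ball of radius [r0 + 1]. The margin [1] over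
    the cocompactness radius makes some weight at each [x] at least [1]. *)
Let w (q : G) (x : X) : R := Num.max 0 (r0 + 1 - `|act q^-1%g x|).

Let w_ge0 q x : 0 <= w q x. Proof. by rewrite le_max lexx. Qed.

Let wrep q x : w (rep q) x = w q x.
Proof.
rewrite /w; congr (Num.max _ (_ - `|_|)).
have -> : ((rep q)^-1 = ((rep q)^-1 * q) * q^-1)%g by rewrite mulgK.
by rewrite (ctlM ctl) (ctlN ctl).
Qed.

Let w_act q h x : w q (act h x) = w (h^-1 * q)%g x.
Proof. by rewrite /w -(ctlM ctl) invgM invgK. Qed.

Let w_cont q x : {for x, continuous (w q)}.
Proof.
apply: (@continuous_max R X (fun=> 0)); first exact: cst_continuous.
apply: cvgB; first exact: cvg_cst.
by apply: cvg_norm; exact: (ctl_cont ctl).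
Qed.

(** Local finiteness of the weights: if [w q x] is nonzero, [q] moves a point of the ball of radius
    [r0 + 1] to [x], and properness leaves finitely many such cosets. *)
Let L_spec (r : R) : exists s : seq G, [/\ uniq s, [set` s] `<=` Q &
  forall q x, Q q -> q \notin s -> `|x| <= r -> w q x = 0].
Proof.
have [s sP] := ctl_proper ctl (Num.max r (r0 + 1)).
exists (undup (map rep s)); split; first exact: undup_uniq.
  by move=> x; rewrite /= mem_undup => /mapP[y _ ->]; exact: rep_rep.
move=> q x Qq qs xr; apply/eqP; apply: contraNT qs.
rewrite mem_undup /w => wq.
have qx : `|act q^-1%g x| <= r0 + 1.
  rewrite leNgt; apply: contra wq => wq.
  by rewrite max_l // subr_le0 ltW.
have [] := sP q.
  exists (act q^-1%g x); first by rewrite le_max qx orbT.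
  by rewrite -(ctlM ctl) mulgV (ctl1 ctl) le_max xr.
by move=> h hs nhq; apply/mapP; exists h => //; rewrite -[LHS]Qq; exact/esym/rep_eq.
Qed.

Let L r := proj1_sig (cid (L_spec r)).
Let LP r := proj2_sig (cid (L_spec r)).

Let S (c : G -> R) x := \sum_(q \in Q) (w q x * c q).

Let SE r c x : `|x| <= r -> S c x = \sum_(q <- L r) w q x * c q.
Proof.
move=> xr; have [uL LQ wL] := LP r; rewrite /S (fsbigE (L r)) //.
  by rewrite big_mkcond /=; apply: eq_big_seq => q /LQ Qq; rewrite mem_set.
by move=> q Qq /wL wq; rewrite wq // mul0r.
Qed.

(** Left translation permutes the cosets, so [q |-> rep (g * q)] is a bijection of [Q] along which
    the sum is reindexed. *)
Let S_act c g x : S c (act g x) = S (fun q => c (rep (g * q)%g)) x.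
Proof.
rewrite /S (reindex_fsbig (fun q => rep (g * q)%g) Q Q).
  apply: eq_fsbigr => q _.
  by rewrite w_act -wrep repMr mulKg wrep.
split => [q _|p q /set_mem Qp /set_mem Qq epq|q Qq].
- exact: rep_rep.
- have : rep (g^-1 * rep (g * p))%g = rep (g^-1 * rep (g * q))%g by rewrite epq.
  by rewrite !repMr !mulKg Qp Qq.
- exists (rep (g^-1 * q)%g); first exact: rep_rep.
  by rewrite repMr mulVKg.
Qed.

Let SD c c' x : S (fun q => c q + c' q) x = S c x + S c' x.
Proof.
rewrite !(SE (r := `|x|)) // -big_split /=.
by apply: eq_bigr => q _; rewrite mulrDr.
Qed.

Let S_cst (k : R) x : S (fun=> k) x = k * S (fun=> 1) x.
Proof.
rewrite !(SE (r := `|x|)) // mulr_sumr.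
by apply: eq_bigr => q _; rewrite mulr1 mulrC.
Qed.

Let S_gt0 x : 0 < S (fun=> 1) x.
Proof.
have [g gx] := r0P x.
have wg : 1 <= w (rep g^-1%g) x.
  by rewrite wrep /w invgK le_max; apply/orP; right; lra.
rewrite (SE (r := `|x|)) //; have [uL LQ wL] := LP `|x|.
have gL : rep g^-1%g \in L `|x|.
  apply: contraT => gL; move: wg.
  by rewrite (wL _ x (rep_rep _) gL) // ler10.
rewrite (big_rem _ gL) /= mulr1 ltr_wpDr //; last by lra.
by apply: sumr_ge0 => q _; rewrite mulr1.
Qed.

(** Near [x] all the sums run over one finite list, that of the ball of radius [|x| + 1]. *)
Let S_cont c x : {for x, continuous (S c)}.
Proof.
have : (fun y => \sum_(q <- L (`|x| + 1)) w q y * c q) y @[y --> x] -->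
    \sum_(q <- L (`|x| + 1)) w q x * c q.
  apply: (@continuous_sum_seq _ _ _ (L (`|x| + 1)) (fun q y => w q y * c q)).
  by move=> q; apply: cvgMl; exact: w_cont.
rewrite -(SE (r := `|x| + 1)); last by rewrite lerDl.
apply: cvg_trans; apply: near_eq_cvg.
have := nbhsx_ballx x 1%R ltr01; apply: filterS => y.
rewrite -ball_normE /= => xy; rewrite [RHS](SE (r := `|x| + 1)) //.
have := ler_normD x (y - x); rewrite addrC subrK distrC; lra.
Qed.

(* [d g q] is the integer cocycle of the extension: it depends on [q] only modulo [N],
and [f g x] is the average of [d g q] with weights [w q x] over the cosets [q]. *)
Lemma averaged_cocycle : exists f : G -> X -> R,
  [/\ forall g, continuous (f g),
      forall g h x, f (g * h)%g x = f h x + f g (act h x),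
      forall n x, N n -> f n x = (chi n)%:~R &
      forall g r, exists B, forall x, `|x| <= r -> `|f g x| <= B].
Proof.
exists (fun g x => S (fun q => (d g q)%:~R) x / S (fun=> 1) x); split.
- move=> g x; apply: cvgM; first exact: S_cont.
  by apply: cvgV; [exact: lt0r_neq0|exact: S_cont].
(* The denominator sums the constant [1], hence is invariant under [h], and the quotients share
   it. *)
- move=> g h x; rewrite !S_act -mulrDl -SD; congr (S _ _ / _).
  by apply/funext => q; rewrite dM rmorphD.
- move=> n x Nn.
  rewrite (_ : (fun q => _) = (fun=> (chi n)%:~R)); last first.
    by apply/funext => q; rewrite dN.
  by rewrite S_cst mulfK //; exact: lt0r_neq0.
(* Each weight is at most the total weight, so the sum of the [|d g q|] bounds the average. *)
- move=> g r; exists (\sum_(q <- L r) `|(d g q)%:~R|) => x xr.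
  rewrite normrM normfV (gtr0_norm (S_gt0 x)) ler_pdivrMr // (SE (r := r)) //.
  rewrite mulr_suml; apply: le_trans (ler_norm_sum _ _ _) _.
  rewrite big_seq [leRHS]big_seq; apply: ler_sum => q qL.
  rewrite normrM mulrC ler_wpM2l // ger0_norm // (SE (r := r)) //.
  by rewrite (big_rem _ qL) /= mulr1 lerDl; apply: sumr_ge0 => p _; rewrite mulr1.
Qed.

End Cocycle.

(** * Fast growing homeomorphisms of the line *)

Section Growth.
Variables (R : realType) (T : nat -> R).

(** The ramp of index [k] leaves 0 at [s = k - 1] with slope [|T k|], so it is worth [|T k|] at
    [s = k]. For [s >= 0], [W] collects every ramp that is nonzero at [s]. *)
Let P (n : nat) (s : R) : R := 1 + \sum_(k < n) `|T k| * Num.max 0 (s - k%:R + 1).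
Let W (s : R) : R := P (Num.trunc s).+2 s.

Let P_widen n m s : s <= n%:R -> (n < m)%N -> P m s = P n.+1 s.
Proof.
move=> sn nm; congr (1 + _).
rewrite -(subnK nm) addnC big_split_ord /= [X in _ + X]big1 ?addr0 // => k _.
rewrite max_l ?mulr0 //= natrD -natr1.
have : 0 <= k%:R :> R by []. lra.
Qed.

(** With one fixed number of ramps on all of [[0, n]], continuity and monotonicity of [W] reduce to
    those of [P]. *)
Let WE n s : 0 <= s -> s <= n%:R -> W s = P n.+1 s.
Proof.
move=> s0 sn; have /andP[t1 t2] := truncn_itv s0.
rewrite /W.
have [nt|tn] := leqP n (Num.trunc s).+1.
  by apply: P_widen.
by apply/esym/P_widen; [exact: ltW|exact: leqW].
Qed.

Let P_cont n s : {for s, continuous (P n)}.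
Proof.
apply: cvgD; first exact: cvg_cst.
apply: (@continuous_sum_seq R R _ _ (fun (k : 'I_n) s => `|T k| * Num.max 0 (s - k%:R + 1))) => k /=.
apply: cvgMr; apply: (@continuous_max R R (fun=> 0) (fun s => s - k%:R + 1)); first exact: cst_continuous.
by apply: cvgD; [apply: cvgB; [exact: cvg_id|exact: cvg_cst]|exact: cvg_cst].
Qed.

Let P_ge1 n s : 1 <= P n s.
Proof. by rewrite lerDl; apply: sumr_ge0 => k _; rewrite mulr_ge0 // le_max lexx. Qed.

Let P_mono n s t : s <= t -> P n s <= P n t.
Proof.
move=> st; rewrite lerD2l; apply: ler_sum => k _; rewrite ler_wpM2l //.
rewrite ge_max le_max lexx /= le_max; apply/orP; right; lra.
Qed.

Let W_ge1 s : 1 <= W s. Proof. exact: P_ge1. Qed.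

Let W_mono s t : 0 <= s -> s <= t -> W s <= W t.
Proof.
move=> s0 st; have t0 := le_trans s0 st.
have /andP[_ /ltW tn] := truncn_itv t0.
by rewrite (WE s0 (le_trans st tn)) (WE t0 tn) P_mono.
Qed.

Let E (s : R) : R := s * W `|s|.

Let E_cont : continuous E.
Proof.
move=> s; apply: cvgM; first exact: cvg_id.
have /andP[_ tn] := truncn_itv (normr_ge0 s).
set n := (Num.trunc _).+1 in tn.
have : P n.+1 `|y| @[y --> s] --> P n.+1 `|s|.
  by apply: (@cvg_comp _ _ _ Num.norm (P n.+1)); [apply: cvg_norm; exact: cvg_id|exact: P_cont].
rewrite -(WE (normr_ge0 s) (ltW tn)); apply: cvg_trans; apply: near_eq_cvg.
have e0 : 0 < n%:R - `|s| by rewrite subr_gt0.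
have := nbhsx_ballx s _ e0; apply: filterS => y.
rewrite -ball_normE /= => sy; apply/esym/WE => //.
have := ler_normD s (y - s); rewrite addrC subrK distrC; lra.
Qed.

Let EN s : E (- s) = - E s. Proof. by rewrite /E normrN mulNr. Qed.

Let E_super a b : 0 <= a -> 0 <= b -> E a + E b <= E (a + b).
Proof.
move=> a0 b0; rewrite /E !ger0_norm ?addr_ge0 // mulrDl.
by apply: lerD; rewrite ler_wpM2l // W_mono //; lra.
Qed.

Let E_ge a : 0 <= a -> a <= E a.
Proof. by move=> a0; rewrite /E ger0_norm // ler_peMr. Qed.

(** For [a] and [b] on the same side of 0, superadditivity suffices. Otherwise [|a|] or [b] is at
    least [(b - a) / 2], whence the halving. *)
Let E_diff a b : a <= b -> E ((b - a) / 2) <= E b - E a.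
Proof.
move=> ab; have half c : 0 <= c -> E (c / 2) <= E c.
  move=> c0; rewrite {2}(splitr c); apply: le_trans (E_super _ _) => //; try lra.
  have := @E_ge (c / 2); lra.
have mono x y : 0 <= x -> x <= y -> E x <= E y.
  move=> x0 xy; have := @E_super x (y - x); rewrite subrKC.
  have := @E_ge (y - x); lra.
have [a0|a0] := lerP 0 a.
  have := @E_super a (b - a); rewrite subrKC.
  have := half (b - a); lra.
have [b0|b0] := lerP b 0.
  have := @E_super (- b) (b - a); rewrite addKr !EN.
  have := half (b - a); lra.
have := E_ge (ltW b0); have na0 : 0 <= - a by lra.
have := E_ge na0; rewrite EN.
have [h|h] := lerP (- a) b.
  have := mono ((b - a) / 2) b; lra.
have := mono ((b - a) / 2) (- a); rewrite EN; lra.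
Qed.

(** The witness is [s * W |s|]. Read through [psi], the lower bound on [|E a - E b|] is a modulus of
    continuity for the inverse. *)
Lemma fast_homeomorphism : exists E psi : R -> R,
  [/\ continuous E, continuous psi, cancel E psi & cancel psi E] /\
  [/\ {mono E : x y / x <= y},
      forall x, `|E x| = E `|x|,
      forall a b, E (`|a - b| / 2) <= `|E a - E b|,
      forall a b, 0 <= a -> 0 <= b -> E a + E b <= E (a + b) &
      forall n, (0 < n)%N -> T n <= E n%:R].
Proof.
have E0 : E 0 = 0 by rewrite /E mul0r.
have E_pos c : 0 < c -> 0 < E c by move=> c0; have := E_ge (ltW c0); lra.
have Emono : {mono E : x y / x <= y}.
  apply: le_mono => x y xy.
  have := @E_diff x y (ltW xy); have := E_pos ((y - x) / 2); lra.
have surj y : exists x, E x = y.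
  (* [E] is odd and dominates the identity on nonnegative reals, so its values at the two endpoints
     bracket [y]. *)
  have [c _ Ec] : exists2 c, c \in `[- `|y|, `|y|] & E c = y.
    apply: IVT.
    - by rewrite ge0_cp.
    - exact: continuous_subspaceT.
    - rewrite EN; have yE := E_ge (normr_ge0 y).
      have /andP[y1 y2] : - E `|y| <= y <= E `|y| by rewrite -ler_norml.
      by rewrite ge_min le_max y1 y2 orbT.
  by exists c.
have /choice[psi Epsi] := surj.
have psiE : cancel E psi by move=> x; apply: (inc_inj Emono); rewrite Epsi.
exists E, psi; split; split => //.
- move=> y.
  have c1 : {near psi y, cancel E psi} by apply: filterE => z; exact: psiE.
  have c2 : {near psi y, continuous E} by apply: filterE => z; exact: E_cont.
  by have := nbhs_singleton (near_can_continuous c1 c2); rewrite Epsi.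
- move=> x; have [x0|x0] := ger0P x; first by rewrite ger0_norm // -E0 Emono.
  by rewrite EN ler0_norm // -[leRHS]E0 Emono ltW.
- move=> a b; have [ab|/ltW ab] := lerP a b.
    by rewrite distrC ger0_norm ?subr_ge0 ?Emono //; exact: E_diff.
  by rewrite ger0_norm ?subr_ge0 ?Emono //; exact: E_diff.
- move=> n n0; rewrite /E ger0_norm // (WE (n := n)) //.
  have n1 : 1 <= n%:R :> R by rewrite ler1n.
  apply: le_trans (ler_peMl _ n1); last by have := P_ge1 n.+1 n%:R; lra.
  rewrite /P big_ord_recr /= subrr add0r max_r // mulr1.
  have : 0 <= \sum_(i < n) `|T i| * Num.max 0 (n%:R - i%:R + 1).
    by apply: sumr_ge0 => k _; rewrite mulr_ge0 // le_max lexx.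
  have := ler_norm (T n); lra.
Qed.

End Growth.

(** * Extending a controlled action by one coordinate *)

Lemma fin_mod_sub (G : groupType) (N A B : set G) :
  A `<=` B -> fin_mod N B -> fin_mod N A.
Proof. by move=> AB [s sP]; exists s => g /AB/sP. Qed.

Lemma fin_modU (G : groupType) (N A B : set G) :
  fin_mod N A -> fin_mod N B -> fin_mod N (A `|` B).
Proof.
move=> [s sP] [t tP]; exists (s ++ t) => g [/sP|/tP] [h hs Nh];
  by exists h => //; rewrite mem_cat hs ?orbT.
Qed.

Lemma fin_mod_trans (G : groupType) (N M A : set G) :
  subgroup M -> fin_mod M N -> fin_mod N A -> fin_mod M A.
Proof.
move=> [_ MM _] [s sP] [t tP]; exists [seq (x * y)%g | x <- t, y <- s].
move=> g /tP[h ht /sP[k ks Mk]]; exists (h * k)%g; first exact: allpairs_f.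
by rewrite invgM -mulgA.
Qed.

(** Applied to the norm of a moved point: an error linear in [n] is then negligible against
    [n ^ 2]. *)
Lemma square_bracket (R : realType) (x : R) : 0 <= x ->
  exists n : nat, n%:R ^+ 2 <= x < n.+1%:R ^+ 2.
Proof.
move=> x0; exists (Num.trunc (Num.sqrt x)).
have s0 := sqrtr_ge0 x; have /andP[h1 h2] := truncn_itv s0.
rewrite -{2 3}(sqr_sqrtr x0); apply/andP; split.
  by rewrite ler_sqr ?nnegrE.
by rewrite ltr_sqr ?nnegrE.
Qed.

Section Extension.
Variables (R : realType) (G : groupType) (N M : set G) (chi : G -> int).
Hypotheses (sN : subgroup N) (sM : subgroup M) (sub : M `<=` N).
Hypothesis comm : forall x y, N x -> M [~ x, y]%g.
Hypothesis chiM : forall x y, N x -> N y -> chi (x * y)%g = chi x + chi y.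
Hypothesis chi_ker : forall x, N x -> chi x = 0 <-> M x.
Hypothesis chi_surj : forall k : int, exists2 x, N x & chi x = k.

Let N1 : N 1%g. Proof. by case: sN. Qed.
Let NM x y : N x -> N y -> N (x * y)%g. Proof. by case: sN => _ + _; apply. Qed.
Let NV x : N x -> N (x^-1)%g. Proof. by case: sN => _ _; apply. Qed.

Let chi1 : chi 1%g = 0. Proof. by apply/chi_ker => //; case: sM. Qed.

Let chiV x : N x -> chi (x^-1)%g = - chi x.
Proof.
move=> Nx; apply/eqP; rewrite -addr_eq0 -chiM ?mulVg ?chi1 //; exact: NV.
Qed.

(** Inside a coset [h N] the classes modulo [M] are told apart by [chi], so a bound on [chi] leaves
    finitely many of them; lifts of the integers in range give representatives. *)
Lemma fin_mod_refine (A : set G) : fin_mod N A ->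
  (forall h, exists B : R, forall n, N n -> A (h * n)%g -> `|(chi n)%:~R| <= B) ->
  fin_mod M A.
Proof.
move=> [s sP] /choice[B BP].
have /choice[z zP] : forall k, exists x, N x /\ chi x = k.
  by move=> k; have [x Nx cx] := chi_surj k; exists x.
pose K h := (Num.trunc (B h)).+1.
(* The shifted index runs over all integers from [- K h] to [K h]. *)
exists [seq (h * z (i%:Z - (K h)%:Z))%g | h <- s, i <- iota 0 ((K h).*2.+1)].
move=> g Ag; have [h hs Nhg] := sP _ Ag.
set n := (h^-1 * g)%g in Nhg *.
have gE : g = (h * n)%g by rewrite /n !gnorm.
have kn : (`|chi n| <= K h)%N.
  have := BP h n Nhg; rewrite -gE => /(_ Ag); rewrite -intr_norm -natr_absz.
  move=> cB; have : 0 <= B h by apply: le_trans cB.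
  move=> /truncn_itv/andP[_ Bt]; rewrite -(ler_nat R).
  exact: le_trans cB (ltW Bt).
exists (h * z (chi n))%g.
  apply/allpairsPdep; exists h, (absz (chi n + (K h)%:Z)); split => //.
    by rewrite mem_iota /=; lia.
  by congr (_ * z _)%g; lia.
rewrite gE invgM -mulgA mulKg; have [Nz cz] := zP (chi n).
have Nzn : N ((z (chi n))^-1 * n)%g by apply: NM => //; exact: NV.
by apply/chi_ker => //; rewrite chiM ?chiV ?cz ?addNr //; exact: NV.
Qed.

Variables (X : normedModType R) (act : G -> X -> X).
Hypothesis ctl : controlled N act.

(** Finiteness modulo [M] is proved in two stages through [fin_mod_refine]: first modulo [N], from
    the action on [X]; then inside a coset [h N], where [f (h * n)] is [f h] shifted by [chi n], by
    bounding [chi n]. *)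
Lemma controlled_extension : exists act' : G -> X * R^o -> X * R^o,
  controlled M act'.
Proof.
have chi0 x : M x -> chi x = 0 by move=> Mx; apply/(chi_ker (sub Mx)).
have [f [f_cont fM fN f_bnd]] := averaged_cocycle sN sub comm ctl chiM chi0.
have fgn h n x : N n -> f (h * n)%g x = (chi n)%:~R + f h x.
  by move=> Nn; rewrite fM (fN _ _ Nn) (ctlN ctl _ Nn).
have actn h n x : N n -> act (h * n)%g x = act h x.
  by move=> Nn; rewrite (ctlM ctl) (ctlN ctl _ Nn).
(* [T i] bounds the oscillation of [f g] on the ball of radius [i], for all [g] carrying some point
   of it into the ball of radius [i + 1] squared. Properness leaves finitely many cosets of [N], and
   moving [g] within its coset only adds a constant to [f g]. *)
have /choice[T TP] : forall i : nat, exists T : R,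
    forall g, (exists x, `|x| <= i%:R /\ `|act g x| <= i.+1%:R ^+ 2) ->
    forall y y', `|y| <= i%:R -> `|y'| <= i%:R -> `|f g y - f g y'| <= T.
  move=> i; have [s sP] := ctl_proper ctl (i.+1%:R ^+ 2).
  have /choice[B BP] : forall h, exists B, forall x, `|x| <= i%:R -> `|f h x| <= B.
    by move=> h; exact: f_bnd.
  exists (\sum_(h <- s) 2 * `|B h|) => g [x [xi gxi]] y y' yi y'i.
  have [] := sP g.
    exists x => //; apply: le_trans xi _.
    rewrite -natrX ler_nat; nia.
  move=> h hs; set n := (_ * _)%g => Nn.
  have -> : g = (h * n)%g by rewrite /n !gnorm.
  rewrite !fgn // (big_rem _ hs) /=.
  have : 0 <= \sum_(y <- rem h s) 2 * `|B y| by apply: sumr_ge0 => k _; rewrite mulr_ge0.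
  have := BP h y yi; have := BP h y' y'i; have := ler_norm (B h).
  rewrite opprD addrACA subrr add0r.
  have := ler_normB (f h y) (f h y'); lra.
have [E [psi [[E_cont psi_cont EK psiK] [E_mono E_norm E_diff E_super ET]]]] :=
  fast_homeomorphism T.
have psi_diff c u v : `|u - v| <= E c -> `|psi u - psi v| <= 2 * c.
  move=> uv; have := E_diff (psi u) (psi v); rewrite !psiK => h.
  have := le_trans h uv; rewrite E_mono; lra.
have psi_norm c u : `|psi u| <= c -> `|u| <= E c.
  by rewrite -E_mono -E_norm psiK.
have norm_psi c u : `|u| <= E c -> `|psi u| <= c.
  by move=> uE; rewrite -E_mono -E_norm psiK.
(* In the coordinate [u = E t] the second factor is translated by [f g x]. *)
pose act' g (p : X * R^o) : X * R^o := (act g p.1, psi (E p.2 + f g p.1)).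
have pleft (p : X * R^o) r : `|p| <= r -> `|p.1| <= r.
  by rewrite prod_normE ge_max => /andP[].
have pright (p : X * R^o) r : `|p| <= r -> `|p.2 : R| <= r.
  by rewrite prod_normE ge_max => /andP[].
exists act'; split.
- move=> [x t]; rewrite /act' /= (ctl1 ctl) fN // chi1 addr0 EK //.
- move=> g h [x t]; rewrite /act' /= (ctlM ctl) fM psiK addrA //.
- move=> n [x t] Mn; rewrite /act' /= (ctlN ctl) ?fN ?chi0 ?addr0 ?EK //; exact: sub.
- move=> g.
  have c1 : continuous (fun p : X * R^o => act g p.1).
    move=> p; apply: (@continuous_comp _ _ _ fst (act g)); first exact: cvg_fst.
    exact: (ctl_cont ctl).
  have c2 : continuous (fun p : X * R^o => E p.2 + f g p.1).
    move=> p; apply: cvgD.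
      apply: (@continuous_comp _ _ _ snd E); first exact: cvg_snd.
      exact: E_cont.
    apply: (@continuous_comp _ _ _ fst (f g)); first exact: cvg_fst.
    exact: f_cont.
  have c3 : continuous (fun p : X * R^o => psi (E p.2 + f g p.1)).
    move=> p.
    exact: (@continuous_comp _ R R (fun p : X * R^o => E p.2 + f g p.1) psi p (c2 p) (@psi_cont _)).
  by move=> p A; exact: (cvg_pair (c1 p) (c3 p)).
- move=> g r; have [s sP] := ctl_bounded ctl g r; have [B BP] := f_bnd g r.
  exists (Num.max s (psi (E r + B))) => p pr.
  rewrite prod_normE ge_max !le_max (sP _ (pleft _ _ pr)) /=; apply/orP; right.
  apply: norm_psi; rewrite psiK; apply: le_trans (ler_normD _ _) _.
  by rewrite E_norm lerD ?E_mono ?(pright _ _ pr) // (BP _ (pleft _ _ pr)).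
- move=> r; apply: fin_mod_refine.
    apply: fin_mod_sub (ctl_proper ctl r) => g [p pr gpr].
    by exists p.1; [exact: pleft|exact: (pleft (act' g p))].
  move=> h; have [B BP] := f_bnd h r; exists (2 * E r + B) => n Nn [p pr gpr].
  have := pright _ _ gpr; rewrite /= => /psi_norm; rewrite fgn // => uE.
  have := BP _ (pleft _ _ pr); have := pright _ _ pr; rewrite -E_mono -E_norm.
  set c := (chi n)%:~R in uE *; set u := E p.2 in uE *; set v := f h p.1 in uE *.
  move=> u1 v1; have -> : c = (u + (c + v)) - u - v by ring.
  have := ler_normB (u + (c + v) - u) v; have := ler_normB (u + (c + v)) u; lra.
- have [r rP] := ctl_cocompact ctl; exists (Num.max r (psi 1)) => p.
  (* Acting further by [n] subtracts the integer part and leaves [u] in [[0, 1)], hence the radius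
     [psi 1]. *)
  have [g gr] := rP p.1; have [n Nn cn] := chi_surj (- Num.floor (E p.2 + f g p.1)).
  exists (n * g)%g; rewrite prod_normE ge_max !le_max /=.
  rewrite (ctlM ctl) (ctlN ctl _ Nn) gr /=; apply/orP; right.
  apply: norm_psi; rewrite psiK fM (fN _ _ Nn) cn rmorphN addrA.
  have /andP[h1 h2] := floor_itv (E p.2 + f g p.1).
  by rewrite rmorphD in h2; rewrite ger0_norm; lra.
move=> r e e0; apply: fin_mod_refine.
  (* For [n >= n0] the ball of radius [r] lies in that of radius [n], and [6 n <= e n ^ 2]. *)
  have [n0 n0P] : exists n0 : nat, [/\ (0 < n0)%N, r <= n0%:R & 6 / e <= n0%:R].
    exists (maxn (Num.trunc `|r|) (Num.trunc (6 / e))).+1.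
    have ge0 : 0 <= 6 / e by rewrite divr_ge0 // ltW.
    have /andP[_ h1] := truncn_itv (normr_ge0 r).
    have /andP[_ h2] := truncn_itv ge0.
    split => //.
      apply: le_trans (ler_norm r) _; apply: le_trans (ltW h1) _.
      by rewrite ler_nat ltnS leq_maxl.
    by apply: le_trans (ltW h2) _; rewrite ler_nat ltnS leq_maxr.
  have [n00 rn0 en0] := n0P.
  pose r' := Num.max r (n0%:R ^+ 2).
  apply: fin_mod_sub (fin_modU (ctl_small ctl r e0) (ctl_proper ctl r')).
  move=> g [p [q [pr qr pq]]].
  (* Up to radius [n0 ^ 2] properness on [X] disposes of [g]. Beyond it the second coordinate stays
     within the bound, so a violation comes from the action on [X]. *)
  have [gr'|gr'] := lerP `|act g p.1| (n0%:R ^+ 2).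
    right; exists p.1; rewrite /r' le_max; first by rewrite (pleft _ _ pr).
    by rewrite gr' orbT.
  left; exists p.1, q.1; split; [exact: pleft|exact: pleft|].
  rewrite ltNge; apply/negP => small; move: pq; apply/negP; rewrite -leNgt.
  have e_p : e * `|act g p.1| <= e * `|act' g p|.
    by rewrite ler_pM2l // (pleft (act' g p)).
  rewrite prod_normE ge_max; apply/andP; split; first exact: le_trans e_p.
  apply: le_trans e_p; rewrite /=.
  have [n /andP[n1 n2]] := square_bracket (normr_ge0 (act g p.1)).
  have n0n : (n0 <= n)%N.
    have := lt_trans gr' n2; rewrite -!natrX ltr_nat ltn_sqr; lia.
  have rn : r <= n%:R by apply: le_trans rn0 _; rewrite ler_nat.
  have fpq : `|f g p.1 - f g q.1| <= E n%:R.
    apply: le_trans (ET _ _); last by lia.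
    apply: TP; [|exact: le_trans (pleft _ _ pr) _|exact: le_trans (pleft _ _ qr) _].
    by exists p.1; split; [exact: le_trans (pleft _ _ pr) _|exact: ltW].
  have n_ge0 : 0 <= n%:R :> R by [].
  (* The two values of [u] differ by at most [3 E n <= E (3 n)], so those of [t] differ by at most
     [6 n]. *)
  apply: (@le_trans _ _ (2 * (3 * n%:R))).
    apply: psi_diff.
    have Ep : `|E p.2| <= E n%:R.
      by rewrite E_norm E_mono; exact: le_trans (pright _ _ pr) _.
    have Eq : `|E q.2| <= E n%:R.
      by rewrite E_norm E_mono; exact: le_trans (pright _ _ qr) _.
    have := E_super _ _ n_ge0 n_ge0.
    have := E_super (n%:R + n%:R) _ (addr_ge0 n_ge0 n_ge0) n_ge0.
    rewrite (_ : n%:R + n%:R + n%:R = 3 * n%:R); last by ring.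
    rewrite opprD addrACA.
    have := ler_normD (E p.2 - E q.2) (f g p.1 - f g q.1).
    have := ler_normB (E p.2) (E q.2); lra.
  apply: le_trans (_ : e * n%:R ^+ 2 <= _); last by rewrite ler_pM2l.
  have en : 6 <= e * n%:R.
    rewrite mulrC -ler_pdivrMr //; apply: le_trans en0 _; by rewrite ler_nat.
  by rewrite expr2 !mulrA ler_wpM2r //; lra.
move=> h; have [s sP] := ctl_bounded ctl h r; have [B BP] := f_bnd h r.
(* The shift [chi n] cancels in differences, so [C] bounds the distance of the two images uniformly
   over the coset [h N]. A violation then puts the image of [p] within [C / e], which bounds
   [chi n]. *)
pose C := Num.max (2 * s) (2 * psi (2 * E r + 2 * B)).
exists (E (C / e) + E r + B) => n Nn [p [q [pr qr pq]]].
have Ep : `|E p.2| <= E r by rewrite E_norm E_mono; exact: pright.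
have Eq : `|E q.2| <= E r by rewrite E_norm E_mono; exact: pright.
have fp := BP _ (pleft _ _ pr); have fq := BP _ (pleft _ _ qr).
have diffC : `|act' (h * n)%g p - act' (h * n)%g q| <= C.
  rewrite prod_normE ge_max /C !le_max; apply/andP; split; apply/orP.
    left; rewrite /= !actn //; have := sP _ (pleft _ _ pr).
    have := sP _ (pleft _ _ qr); have := ler_normB (act h p.1) (act h q.1); lra.
  right; apply: psi_diff; rewrite psiK !fgn //.
  rewrite opprD addrACA opprD (addrACA (chi n)%:~R) subrr add0r.
  have := ler_normD (E p.2 - E q.2) (f h p.1 - f h q.1).
  have := ler_normB (E p.2) (E q.2); have := ler_normB (f h p.1) (f h q.1); lra.
have : `|act' (h * n)%g p| <= C / e.
  by rewrite ler_pdivlMr // mulrC; apply: ltW (lt_le_trans pq _).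
move=> /pright /psi_norm; rewrite /= fgn // => uE.
set c := (chi n)%:~R in uE *; set u := E p.2 in uE Ep *; set v := f h p.1 in uE fp *.
have -> : c = (u + (c + v)) - u - v by ring.
have := ler_normB (u + (c + v) - u) v; have := ler_normB (u + (c + v)) u; lra.
Qed.

End Extension.

(** * Transport to row vectors and descent along the central chain *)

Lemma isometry_continuous (R : realType) (X Y : normedModType R) (f : X -> Y) :
  (forall x y, `|f x - f y| = `|x - y|) -> continuous f.
Proof.
move=> fi x; apply/cvgrPdist_lt => e e0; near=> y; rewrite fi.
by near: y; exact: cvgr_dist_lt.
Unshelve. all: by end_near. Qed.

(** An isometry fixing 0 preserves norms as well as distances, so every clause transfers; this turns
    [X * R^o] into row vectors. *)
Lemma controlled_isometry (R : realType) (G : groupType) (N : set G)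
    (X Y : normedModType R) (act : G -> X -> X) (phi : X -> Y) (psi : Y -> X) :
  cancel phi psi -> cancel psi phi ->
  (forall x y, `|phi x - phi y| = `|x - y|) -> phi 0 = 0 ->
  controlled N act -> controlled N (fun g y => phi (act g (psi y))).
Proof.
move=> phiK psiK iso phi0 ctl.
have norm_phi x : `|phi x| = `|x| by rewrite -[phi x]subr0 -phi0 iso subr0.
have norm_psi y : `|psi y| = `|y| by rewrite -norm_phi psiK.
have psi_iso y z : `|psi y - psi z| = `|y - z| by rewrite -iso !psiK.
split.
- by move=> y; rewrite (ctl1 ctl) psiK.
- by move=> g h y; rewrite (ctlM ctl) phiK.
- by move=> n y Nn; rewrite (ctlN ctl _ Nn) psiK.
- move=> g y; apply: (@continuous_comp _ _ _ (act g \o psi) phi); last exact: isometry_continuous.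
  apply: (@continuous_comp _ _ _ psi (act g)); last exact: (ctl_cont ctl).
  exact: isometry_continuous.
- move=> g r; have [s sP] := ctl_bounded ctl g r; exists s => y yr.
  by rewrite norm_phi sP // norm_psi.
- move=> r; apply: fin_mod_sub (ctl_proper ctl r) => g [y yr gyr].
  by exists (psi y); [rewrite norm_psi|rewrite -norm_phi].
- have [r rP] := ctl_cocompact ctl; exists r => y.
  by have [g gr] := rP (psi y); exists g; rewrite norm_phi.
- move=> r e e0; apply: fin_mod_sub (ctl_small ctl r e0) => g [y [z [yr zr yz]]].
  exists (psi y), (psi z); rewrite !norm_psi; split => //.
  by move: yz; rewrite norm_phi iso.
Qed.

Lemma rV_norm_leP (R : realType) n (x : 'rV[R]_n) (c : R) : 0 <= c ->
  reflect (forall i, `|x ord0 i| <= c) (`|x| <= c).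
Proof.
move=> c0; rewrite [Num.norm x](mx_normrE x); apply: (iffP (bigmax_leP _ _ _ _)).
  by move=> [_ h] i; exact: (h (ord0, i)).
by move=> h; split => // -[i j] _; rewrite /= (ord1 i).
Qed.

Lemma rV_coord_norm (R : realType) n (x : 'rV[R]_n) i : `|x ord0 i| <= `|x|.
Proof. exact: (rV_norm_leP x (normr_ge0 x) _). Qed.

Lemma row_mx_norm (R : realType) n (x : 'rV[R]_n) (t : R) :
  `|row_mx x (const_mx t : 'rV_1)| = Num.max `|x| `|t|.
Proof.
apply/eqP; rewrite eq_le; apply/andP; split.
  have m0 : 0 <= Num.max `|x| `|t| by rewrite le_max normr_ge0.
  apply/(rV_norm_leP _ m0) => i.
  rewrite le_max mxE; case: (fintype.split i) => k; first by rewrite rV_coord_norm.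
  by rewrite mxE lexx orbT.
rewrite ge_max; apply/andP; split.
  apply/(rV_norm_leP _ (normr_ge0 _)) => i.
  have := rV_coord_norm (row_mx x (const_mx t : 'rV_1)) (lshift 1 i).
  by rewrite row_mxEl.
have := rV_coord_norm (row_mx x (const_mx t : 'rV_1)) (rshift n ord0).
by rewrite row_mxEr mxE.
Qed.

Lemma euclidean_controlled (R : realType) (G : groupType) :
  finitely_generated G -> nilpotent G ->
  exists n (act : G -> 'rV[R]_n -> 'rV[R]_n), controlled [set 1%g] act.
Proof.
move=> fgG nilG.
apply: (@nilpotent_fg_ind G (fun N =>
  exists n (act : G -> 'rV[R]_n -> 'rV[R]_n), controlled N act)) => //.
  (* Modulo [G] itself, the trivial action on the one-point space [R^0] is controlled. *)
  exists 0%N, (fun _ x => x).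
  have finT A : fin_mod [set: G] A by exists [:: 1%g] => g _; exists 1%g; rewrite ?inE.
  split => //.
  - by move=> g x; exact: cvg_id.
  - by move=> g r; exists r.
  - by exists 0 => x; exists 1%g; rewrite (thinmx0 x) normr0.
move=> N M st [n [act ctl]].
have [sN sM MN NM _] := st.
case: (central_step_cyclic st) => [fMN|[chi [chiM chi0 chi_surj]]].
  (* When [N / M] is finite the same action serves: finiteness modulo [N] implies finiteness modulo
     [M]. *)
  exists n, act; case: ctl => c1 cM cN cc cb cp cco cs; split => //.
  - by move=> m x /MN; exact: cN.
  - by move=> r; exact: fin_mod_trans fMN (cp r).
  - by move=> r e e0; exact: fin_mod_trans fMN (cs r e e0).
have [act' ctl'] := controlled_extension sN sM MN NM chiM chi0 chi_surj ctl.
pose phi (p : 'rV[R]_n * R^o) : 'rV[R]_(n + 1) := row_mx p.1 (const_mx p.2).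
pose psi (y : 'rV[R]_(n + 1)) : 'rV[R]_n * R^o := (lsubmx y, rsubmx y ord0 ord0).
exists (n + 1)%N, (fun g y => phi (act' g (psi y))).
apply: controlled_isometry ctl'.
- by move=> [x t]; rewrite /phi /psi /= row_mxKl row_mxKr mxE.
- move=> y; rewrite /phi /psi /= -[RHS]hsubmxK; congr row_mx.
  by apply/rowP => i; rewrite !ord1 mxE.
- move=> [x t] [x' t']; rewrite /phi /= opp_row_mx add_row_mx prod_normE /=.
  rewrite -row_mx_norm; congr (`|row_mx _ _|).
  by apply/rowP => i; rewrite !mxE.
- by rewrite /phi /= -row_mx0; congr row_mx; apply/rowP => i; rewrite !mxE.
Qed.

(** * The unit ball as a space *)

Lemma rV_continuous (R : realType) (T : topologicalType) n (f : T -> 'rV[R]_n) :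
  (forall i, continuous (fun x => f x ord0 i)) -> continuous f.
Proof.
move=> cf x; apply/cvgrPdist_le => e e0.
have : \forall y \near x, forall i, `|f x ord0 i - f y ord0 i| <= e.
  apply: filter_forall => i.
  have /cvgrPdist_le := cf i x; exact.
apply: filterS => y fxy; apply/rV_norm_leP => [|i]; first exact: ltW.
by rewrite !mxE.
Qed.

(** Near-covering compactness: half the radius of a ball around [x] inside a member of [C] works for
    all points near [x]. *)
Lemma lebesgue_number (R : realType) (T : pseudoMetricType R) (C : set (set T)) :
  compact [set: T] -> (forall U, C U -> open U) ->
  \bigcup_(U in C) U = [set: T] ->
  exists2 e : R, 0 < e & forall x, exists2 U, C U & ball x e `<=` U.
Proof.
move=> /compact_near_coveringP cT openC coverC.
pose P (e : R) (x : T) := exists2 U, C U & ball x e `<=` U.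
have : \forall e \near (0 : R)^'+, [set: T] `<=` P e.
  apply: cT => x _.
  have [U CU Ux] : (\bigcup_(U in C) U) x by rewrite coverC.
  have /nbhs_ballP[e /= e0 eU] : nbhs x U by apply: open_nbhs_nbhs; split => //; exact: openC.
  have e20 : 0 < e / 2 by rewrite divr_gt0.
  near=> y d => /=; exists U => // z yz; apply: eU.
  rewrite [e]splitr; apply: (@ball_triangle _ _ y).
    by near: y; exact: nbhsx_ballx.
  apply: le_ball yz; near: d; exact: nbhs_right_le.
move=> H; near (0 : R)^'+ => e; exists e => // x.
by move: x I; near: e.
Unshelve. all: by end_near. Qed.

Lemma scale_norm_continuous (R : realType) (X : normedModType R) (f : R -> R) (x : X) :
  {for `|x|, continuous f} -> f `|x| != 0 ->
  {for x, continuous (fun y : X => (f `|y|)^-1 *: y)}.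
Proof.
move=> cf fx0.
have c1 : (f `|y|)^-1 @[y --> x] --> (f `|x|)^-1.
  apply: cvgV; first exact: fx0.
  exact: (@continuous_comp X R R Num.norm f x (@norm_continuous _ X x) cf).
exact: (cvgZ c1 cvg_id).
Qed.

Section UnitBall.
Variables (R : realType) (n : nat).
Implicit Types y : 'rV[R]_n.

(** The norm on row vectors is the sup norm, so this is a cube; the round sphere enters only when
    boundaries are compared. *)
Definition unit_ball : set 'rV[R]_n := [set y | `|y| <= 1].

(** The radial retraction onto the ball, which makes [ball_proj] total. *)
Definition clamp y : 'rV[R]_n := (Num.max 1 `|y|)^-1 *: y.

Let max_gt0 y : 0 < Num.max 1 `|y|. Proof. by rewrite lt_max ltr01. Qed.

Lemma clamp_unit_ball y : unit_ball (clamp y).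
Proof.
rewrite /unit_ball /= normrZ normfV (gtr0_norm (max_gt0 y)) mulrC.
by rewrite ler_pdivrMr // mul1r le_max lexx orbT.
Qed.

Lemma clamp_id y : `|y| <= 1 -> clamp y = y.
Proof. by move=> y1; rewrite /clamp max_l // invr1 scale1r. Qed.

Lemma clamp_continuous : continuous clamp.
Proof.
move=> y; apply: scale_norm_continuous; last exact: lt0r_neq0 (max_gt0 y).
apply: (@continuous_max R R (fun=> 1) id); first exact: cst_continuous.
exact: cvg_id.
Qed.

Definition ball_proj y : unit_ball := exist _ (clamp y) (mem_set (clamp_unit_ball y)).

Lemma ball_projK y : `|y| <= 1 -> set_val (ball_proj y) = y.
Proof. exact: clamp_id. Qed.

Lemma unit_ballP (x : unit_ball) : `|set_val x| <= 1.
Proof. exact: (set_valP x). Qed.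

Lemma set_valK (x : unit_ball) : ball_proj (set_val x) = x.
Proof. by apply: val_inj; rewrite /= clamp_id //; exact: unit_ballP. Qed.

Lemma ball_val_continuous : continuous (set_val : unit_ball -> 'rV[R]_n).
Proof. exact: initial_continuous. Qed.

Lemma ball_proj_continuous : continuous ball_proj.
Proof. by apply: continuous_comp_initial; exact: clamp_continuous. Qed.

Lemma rV_closed_ball_compact (r : R) : compact [set y : 'rV[R]_n | `|y| <= r].
Proof.
apply: bounded_closed_compact.
  exists r; split; first exact: num_real.
  by move=> s rs y /= yr; exact: le_trans yr (ltW rs).
apply: (@preimage_closed 'rV[R]_n R Num.norm [set t | t <= r]); last exact: closed_le.
by move=> y _; exact: norm_continuous.
Qed.

Lemma unit_ball_compact : compact [set: unit_ball].
Proof.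
have -> : [set: unit_ball] = ball_proj @` [set y | `|y| <= 1].
  apply/seteqP; split => // x _; exists (set_val x); first exact: unit_ballP.
  exact: set_valK.
apply: continuous_compact; last exact: rV_closed_ball_compact.
by apply: continuous_subspaceT; exact: ball_proj_continuous.
Qed.

Lemma unit_ball_hausdorff : hausdorff_space unit_ball.
Proof.
move=> x y xy; apply: val_inj; apply: norm_hausdorff => A B nA nB.
have [z [Az Bz]] := xy _ _ (ball_val_continuous nA) (ball_val_continuous nB).
by exists (set_val z).
Qed.

Lemma unit_ball_separable : separable_space unit_ball.
Proof.
pose q (v : 'rV[rat]_n) : 'rV[R]_n := \row_i ratr (v ord0 i).
exists (range (ball_proj \o q)); split.
  by apply: card_le_trans (card_image_le _ _) _; exact: countableP.
apply/seteqP; split => // x _ A nA.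
have : nbhs (set_val x) (ball_proj @^-1` A).
  by apply: ball_proj_continuous; rewrite set_valK.
move=> /nbhs_ballP[e /= e0 eA].
have /choice[r rP] : forall i : 'I_n, exists r : rat, `|set_val x ord0 i - ratr r| < e.
  move=> i; have := @rat_in_itvoo R (set_val x ord0 i - e) (set_val x ord0 i + e).
  rewrite ltrBlDr -addrA ltrDl addr_gt0 // => /(_ isT)[r].
  rewrite in_itv /= => /andP[r1 r2]; exists r.
  by rewrite ltr_norml; apply/andP; split; lra.
exists (ball_proj (q (\row_i r i))); split; first by exists (\row_i r i).
apply: eA; split => // i j; rewrite (ord1 i) !mxE.
exact: rP.
Qed.

End UnitBall.

(** * Radial compression of a normed space into its unit ball *)

Section RadialCompactification.
Variables (R : realType) (X : normedModType R).
Implicit Types x y : X.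

Definition contract x : X := (1 + `|x|)^-1 *: x.
Definition expand y : X := (1 - `|y|)^-1 *: y.

Let pos x : 0 < 1 + `|x|. Proof. by rewrite ltr_pwDl. Qed.

Lemma contract_norm x : `|contract x| = `|x| / (1 + `|x|).
Proof. by rewrite normrZ normfV (gtr0_norm (pos x)) mulrC. Qed.

Lemma contract_lt1 x : `|contract x| < 1.
Proof. by rewrite contract_norm ltr_pdivrMr // mul1r ltrDr. Qed.

Lemma contractK : cancel contract expand.
Proof.
move=> x; rewrite /expand contract_norm scalerA -[RHS]scale1r; congr (_ *: _).
have /lt0r_neq0 px := pos x; field; rewrite px /=.
by rewrite addrK oner_neq0.
Qed.

Lemma expandK y : `|y| < 1 -> contract (expand y) = y.
Proof.
move=> y1; have p : 0 < 1 - `|y| by rewrite subr_gt0.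
rewrite /contract /expand normrZ normfV (gtr0_norm p) scalerA -[RHS]scale1r.
congr (_ *: _); have /lt0r_neq0 py := p; field; rewrite py /=.
by rewrite subrK oner_neq0.
Qed.

Lemma contract_continuous : continuous contract.
Proof.
move=> x; apply: (@scale_norm_continuous R X (fun t => 1 + t)); last exact: lt0r_neq0.
by apply: cvgD; [exact: cvg_cst|exact: cvg_id].
Qed.

Lemma expand_continuous y : `|y| < 1 -> {for y, continuous expand}.
Proof.
move=> y1; apply: (@scale_norm_continuous R X (fun t => 1 - t)).
  by apply: cvgB; [exact: cvg_cst|exact: cvg_id].
by apply: lt0r_neq0; rewrite subr_gt0.
Qed.

(** The difference splits into a rescaled [x - y] and a multiple of [y]. The reverse triangle
    inequality and [|y| <= 1 + |y|] bound the second term, so each contributes half. *)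
Lemma contract_dist x y : `|contract x - contract y| <= 2 * (`|x - y| / (1 + `|x|)).
Proof.
have px := pos x; have py := pos y.
have nx := lt0r_neq0 px; have ny := lt0r_neq0 py.
have -> : contract x - contract y =
    (1 + `|x|)^-1 *: (x - y) + ((1 + `|x|)^-1 * ((`|y| - `|x|) / (1 + `|y|))) *: y.
  rewrite /contract scalerBr -addrA; congr (_ + _); rewrite -!scaleNr -scalerDl.
  by congr (_ *: _); field; rewrite nx ny.
apply: le_trans (ler_normD _ _) _; rewrite mulr_natl mulr2n; apply: lerD.
  by rewrite normrZ normfV (gtr0_norm px) mulrC.
rewrite normrZ !normrM !normfV (gtr0_norm px) (gtr0_norm py).
rewrite -mulrA mulrC ler_pM2r ?invr_gt0 //.
rewrite -mulrA; apply: (@le_trans _ _ `| `|y| - `|x| |).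
  by rewrite ler_piMr // mulrC ler_pdivrMr // mul1r lerDr.
by rewrite distrC; exact: ler_dist_dist.
Qed.

End RadialCompactification.

(** * The ball as an AR with a Z-set boundary *)

Section UnitBallSpace.
Variable n : nat.
Notation V := 'rV[RR]_n.
Notation K := (@unit_ball RR n).

(** Shrinking to the centre serves both as the contraction and as the homotopy off the boundary;
    [ball_proj] keeps it defined for times outside [[0, 1]]. *)
Definition ball_contraction (p : K * RR) : K := ball_proj ((1 - p.2) *: set_val p.1).

Lemma ball_contraction_continuous : continuous ball_contraction.
Proof.
have c1 : continuous (fun p : K * RR => (1 - p.2) *: set_val p.1 : V).
  move=> p; apply: cvgZ.
    by apply: cvgB; [exact: cvg_cst|exact: cvg_snd].
  apply: (@continuous_comp _ _ _ fst set_val); first exact: cvg_fst.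
  exact: ball_val_continuous.
move=> p; exact: (continuous_comp (c1 p) (@ball_proj_continuous _ _ _)).
Qed.

Lemma ball_contraction_val (x : K) t : 0 <= t <= 1 ->
  set_val (ball_contraction (x, t)) = (1 - t) *: set_val x.
Proof.
move=> /andP[t0 t1]; apply: ball_projK; rewrite normrZ ger0_norm ?subr_ge0 //=.
by rewrite mulr_ile1 ?subr_ge0 ?unit_ballP // gerBl.
Qed.

Lemma ball_contraction0 x : ball_contraction (x, 0) = x.
Proof. by rewrite /ball_contraction /= subr0 scale1r set_valK. Qed.

Lemma ball_contraction1 x : ball_contraction (x, 1) = ball_proj 0.
Proof. by rewrite /ball_contraction /= subrr scale0r. Qed.

(** Tietze extension of each coordinate, followed by [ball_proj], retracts all of [Y]. *)
Lemma unit_ball_ANR : ANR K.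
Proof.
move=> Y hY h [h_cont [h_inj [h_closed [g [g_cont gh]]]]].
have coord i : exists f : Y -> RR, [/\ continuous f,
    forall y, `|f y| <= 1 & forall x, f (h x) = set_val x ord0 i].
  pose f0 (y : Y) : RR^o := set_val (g y) ord0 i.
  have f0_cont : {within range h, continuous f0}.
    apply: (@within_continuous_comp _ _ _ (range h) g
      (fun z : K => (set_val z ord0 i : RR^o))) g_cont.
    move=> z _; apply: (@continuous_comp K V RR set_val (fun v => v ord0 i)).
      exact: ball_val_continuous.
    exact: coord_continuous.
  have f0_le y : range h y -> `|f0 y| <= 1.
    by move=> _; apply: le_trans (rV_coord_norm _ _) (unit_ballP _).
  have [f [f0f f_cont f_le]] :=
    continuous_bounded_extension pseudometric_normal h_closed ltr01 f0_cont f0_le.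
  exists f; split => // x; rewrite -f0f; last by rewrite inE; exists x.
  by rewrite /f0 gh.
have /choice[f fP] := coord.
pose r (y : Y) : V := \row_i f i y.
exists setT, (fun y => ball_proj (r y)); split; first exact: openT.
split => //; split.
  have r_cont : continuous r.
    apply: rV_continuous => i.
    rewrite (_ : (fun y => _) = f i); first by have [] := fP i.
    by apply/funext => z; rewrite mxE.
  apply: continuous_subspaceT => y.
  exact: (continuous_comp (r_cont y) (@ball_proj_continuous _ _ _)).
move=> x; rewrite -[RHS]set_valK; congr ball_proj.
by apply/rowP => i; rewrite mxE; have [_ _ ->] := fP i.
Qed.

Lemma unit_ball_AR : AR K.
Proof.
split; first exact: unit_ball_hausdorff.
split; first by move=> x; exists setT; split; [exact: unit_ball_compact|exact: filterT].
split; first exact: unit_ball_separable.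
split; last exact: unit_ball_ANR.
exists ball_contraction, (ball_proj 0); split.
  by apply: continuous_subspaceT; exact: ball_contraction_continuous.
by split; [exact: ball_contraction0|exact: ball_contraction1].
Qed.

Definition ball_boundary : set K := [set x | `|set_val x| = 1].

Lemma ball_boundaryC (x : K) : (~` ball_boundary) x <-> `|set_val x| < 1.
Proof.
rewrite lt_neqAle unit_ballP andbT; split=> [/eqP//|/eqP h]; exact: h.
Qed.

Lemma ball_boundary_Zset : Zset ball_boundary.
Proof.
split.
  apply: (@preimage_closed K RR (fun x => `|set_val x|) [set 1]); last exact: closed_eq.
  move=> x _; apply: (@continuous_comp K V RR set_val Num.norm).
    exact: ball_val_continuous.
  exact: norm_continuous.
exists ball_contraction; split.
  by apply: continuous_subspaceT; exact: ball_contraction_continuous.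
split; first exact: ball_contraction0.
move=> y t /andP[t0 t1]; apply/ball_boundaryC.
rewrite ball_contraction_val ?(ltW t0) // normrZ ger0_norm ?subr_ge0 //.
apply: (@le_lt_trans _ _ (1 - t)); last by lra.
by rewrite ler_piMr ?subr_ge0 // unit_ballP.
Qed.

End UnitBallSpace.

(** * The boundary sphere *)

Section Euclid.
Variables (R : realType) (n : nat).
Implicit Types v : 'rV[R]_n.

Definition euclid v : R := Num.sqrt (\sum_(i < n) v ord0 i ^+ 2).

Lemma euclidZ c v : euclid (c *: v) = `|c| * euclid v.
Proof.
rewrite /euclid -sqrtr_sqr -sqrtrM ?sqr_ge0 // mulr_sumr; congr Num.sqrt.
by apply: eq_bigr => i _; rewrite mxE exprMn.
Qed.

Lemma euclid_gt0 v : v != 0 -> 0 < euclid v.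
Proof.
move=> v0; rewrite sqrtr_gt0 lt_neqAle sumr_ge0 => [|i _]; last exact: sqr_ge0.
rewrite andbT eq_sym; apply: contra v0.
rewrite psumr_eq0 => [|i _]; last exact: sqr_ge0.
move=> /allP v0; apply/eqP/rowP => i; rewrite mxE; apply/eqP.
by rewrite -sqrf_eq0; apply: v0; rewrite mem_index_enum.
Qed.

Lemma euclid_continuous : continuous euclid.
Proof.
have c1 : continuous (fun v => \sum_(i < n) v ord0 i ^+ 2).
  move=> v; apply: (@continuous_sum_seq R _ _ _ (fun (i : 'I_n) v => v ord0 i ^+ 2)) => i.
  exact: (continuous_comp (@coord_continuous R 1 n ord0 i v) (@exprn_continuous R 2 _)).
move=> v; exact: (continuous_comp (c1 v) (@sqrt_continuous R _)).
Qed.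

End Euclid.

(** Radial rescaling: divide by the Euclidean norm one way and by the sup norm the other. For
    [n = 0] both sets are empty. *)
Lemma ball_boundary_sphere n : homeomorphic_sets (@ball_boundary n) (sphere n).
Proof.
have sph v : sphere n v -> euclid v = 1 by rewrite /sphere /euclid /= => ->; rewrite sqrtr1.
have sph' v : euclid v = 1 -> sphere n v.
  rewrite /sphere /euclid /= => v1; have := sqr_sqrtr (a := \sum_(i < n) v ord0 i ^+ 2).
  rewrite v1 expr1n => <- //; apply: sumr_ge0 => i _; exact: sqr_ge0.
have bd0 (x : @unit_ball RR n) : ball_boundary x -> set_val x != 0.
  by rewrite -normr_eq0 => ->; rewrite oner_neq0.
have sph0 v : sphere n v -> v != 0.
  move=> /sph v1; apply: contra_eq_neq v1 => ->.
  by rewrite -(scale0r 0) euclidZ normr0 mul0r eq_sym oner_neq0.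
exists (fun x => (euclid (set_val x))^-1 *: set_val x),
       (fun v => ball_proj (`|v|^-1 *: v)).
split.
  apply: continuous_in_subspaceT => x; rewrite inE => bx.
  have vx := @ball_val_continuous RR n x.
  have ex := continuous_comp vx (@euclid_continuous RR n _).
  have ix := cvgV (lt0r_neq0 (euclid_gt0 (bd0 _ bx))) ex.
  have ix' : (euclid (set_val z))^-1 @[z --> x] --> (euclid (set_val x))^-1 by exact: ix.
  have vx' : set_val z @[z --> x] --> set_val x by exact: vx.
  exact: (cvgZ ix' vx').
split.
  apply: continuous_in_subspaceT => v; rewrite inE => /sph0; rewrite -normr_eq0 => v0.
  have c1 := @scale_norm_continuous RR 'rV[RR]_n id v cvg_id v0.
  exact: (continuous_comp c1 (@ball_proj_continuous RR n _)).
have norm1 v : v != 0 -> `| `|v|^-1 *: v | = 1 :> RR.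
  by rewrite -normr_eq0 => v0; rewrite normrZ normfV normr_id mulVf.
split.
  move=> _ [x /bd0 x0 <-]; apply: sph'.
  by rewrite euclidZ normfV gtr0_norm ?euclid_gt0 // mulVf // lt0r_neq0 // euclid_gt0.
split.
  move=> _ [v /sph0 v0 <-]; rewrite /ball_boundary /=.
  by rewrite -[LHS]/(`|set_val _|) ball_projK norm1.
split.
  move=> x bx; have x0 := bd0 _ bx; have e0 := euclid_gt0 x0.
  rewrite -[RHS]set_valK; congr ball_proj.
  rewrite normrZ normfV (gtr0_norm e0) [X in _ * X]bx mulr1 invrK scalerA.
  by rewrite mulfV ?scale1r // lt0r_neq0.
move=> v sv; have v0 := sph0 _ sv; rewrite ball_projK ?norm1 //.
rewrite euclidZ (sph _ sv) mulr1 normfV normr_id invrK scalerA.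
by rewrite mulfV ?scale1r // normr_eq0.
Qed.

(** * The action on the open ball and the Z-structure *)

Section BallAction.
Variables (G : groupType) (n : nat) (act : G -> 'rV[RR]_n -> 'rV[RR]_n).
Hypothesis ctl : controlled [set 1%g] act.
Notation K := (@unit_ball RR n).
Notation V := 'rV[RR]_n.
Let X := ~` (@ball_boundary n).

(** The action is conjugated into the open ball. On the boundary [1 - |y|] is 0 with inverse 0 by
    convention, so [expand] gives 0 and [ball_act g] is constant there. *)
Definition ball_act (g : G) (y : K) : K := ball_proj (contract (act g (expand (set_val y)))).

Let val_ball_act g y : set_val (ball_act g y) = contract (act g (expand (set_val y))).
Proof. by apply: ball_projK; exact: ltW (contract_lt1 _). Qed.

Let expand_ball_act g y : expand (set_val (ball_act g y)) = act g (expand (set_val y)).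
Proof. by rewrite val_ball_act contractK. Qed.

Let X_expand y : X y -> ball_proj (contract (expand (set_val y))) = y.
Proof. by move=> /ball_boundaryC y1; rewrite expandK // set_valK. Qed.

Let contract_proj_cont : continuous (fun v : V => ball_proj (contract v)).
Proof.
move=> v; exact: (continuous_comp (@contract_continuous RR V v) (@ball_proj_continuous RR n _)).
Qed.

Let expand_val_cont y : X y -> {for y, continuous (fun y : K => expand (set_val y))}.
Proof.
move=> /ball_boundaryC y1.
exact: (continuous_comp (@ball_val_continuous RR n y) (expand_continuous y1)).
Qed.

(** Passes from compact sets to bounded ones, the language of [controlled]. *)
Let compact_expand (S : set K) : S `<=` X -> compact S ->
  exists r, forall y, S y -> `|expand (set_val y)| <= r.
Proof.
move=> SX cS.
have /compact_bounded[r [_ rP]] : compact [set expand (set_val y) | y in S].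
  apply: continuous_compact cS; apply: continuous_in_subspaceT => y.
  by rewrite inE => /SX; exact: expand_val_cont.
by exists (r + 1) => y Sy; apply: rP; [rewrite ltrDl|exists y].
Qed.

Let fin_mod1 (S : set G) : fin_mod [set 1%g] S -> finite_set S.
Proof.
move=> [s sP]; apply: (sub_finite_set _ (finite_seq s)) => g /sP[h hs /= hg].
by rewrite (_ : g = h) //; apply/esym/(mulgI h^-1%g); rewrite hg mulVg.
Qed.

Lemma ball_act_action : is_action X ball_act.
Proof.
split; first by move=> y Xy; rewrite /ball_act (ctl1 ctl) X_expand.
split; first by move=> g h y _; rewrite {1}/ball_act (ctlM ctl) -expand_ball_act.
split.
  by move=> g y _; apply/ball_boundaryC; rewrite val_ball_act contract_lt1.
move=> g; apply: continuous_in_subspaceT => y; rewrite inE => Xy.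
have c0 : {for expand (set_val y), continuous (act g)} by exact: (ctl_cont ctl).
have c1 := continuous_comp (expand_val_cont Xy) c0.
have c2 : {for act g (expand (set_val y)), continuous (fun v : V => ball_proj (contract v))}.
  exact: contract_proj_cont.
exact: (continuous_comp c1 c2).
Qed.

Lemma ball_act_proper : proper_action X ball_act.
Proof.
move=> S SX cS; have [r rP] := compact_expand SX cS.
apply: fin_mod1; apply: fin_mod_sub (ctl_proper ctl r) => g [_ [[y Sy <-] Sgy]].
by exists (expand (set_val y)); [exact: rP|rewrite -expand_ball_act; exact: rP].
Qed.

(** The cover is pulled back to row vectors, where finitely many members cover the closed ball of
    radius [r]; invariance of the members spreads this over all orbits. *)
Lemma ball_act_cocompact : cocompact_action X ball_act.
Proof.
move=> C openC coverC; have [r rP] := ctl_cocompact ctl.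
have : cover_compact [set v : V | `|v| <= r].
  by rewrite -compact_cover; exact: rV_closed_ball_compact.
move=> /(_ _ C (fun U => (fun v => ball_proj (contract v)) @^-1` U)) [].
- move=> U /openC[oU _]; apply: open_comp oU => v _; exact: contract_proj_cont.
- move=> v _; have [U CU Uv] : (\bigcup_(U in C) U) (ball_proj (contract v)).
    apply: coverC; apply/ball_boundaryC.
    by rewrite ball_projK ?contract_lt1 // ltW // contract_lt1.
  by exists U.
move=> D DC coverD; exists [set` D]; split; first exact: finite_fset.
have DC' : [set` D] `<=` C by move=> U /DC; rewrite inE.
split => // y Xy; have [g gy] := rP (expand (set_val y)).
have [U DU Uv] := coverD _ gy; exists U => //.
have [_ [_ Uinv]] := openC _ (DC' _ DU).
apply: (Uinv g^-1%g); exists (ball_act g y) => //.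
rewrite /ball_act -/(ball_act g y) expand_ball_act -(ctlM ctl) mulVg (ctl1 ctl).
exact: X_expand.
Qed.

(** All but finitely many [g] make the image of [S] small relative to its distance from 0 before
    contraction; [contract_dist] then puts it inside a ball of Lebesgue radius. *)
Lemma ball_act_null (S : set K) : S `<=` X -> compact S ->
  null_family [set B | exists g, B = ball_act g @` S].
Proof.
move=> SX cS C openC coverC; have [r rP] := compact_expand SX cS.
have [d d0 dP] := lebesgue_number (@unit_ball_compact RR n) openC coverC.
(* [contract_dist] doubles the relative size, so [d / 4] leads to distances at most [d / 2]. *)
have d40 : 0 < d / 4 by rewrite divr_gt0.
have finF := finite_image (fun g => ball_act g @` S) (fin_mod1 (ctl_small ctl r d40)).
apply: sub_finite_set finF => _ [[g ->] /= bad]; exists g => //=.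
apply: contrapT => nF; apply: bad.
(* An empty [S] has empty images; any member of the cover will do, and the centre supplies one. *)
have [[y Sy]|S0] := pselect (exists y, S y); last first.
  have [U CU _] := dP (ball_proj 0); exists U; split => // ? [y Sy].
  by exfalso; apply: S0; exists y.
have [U CU dU] := dP (ball_act g y); exists U; split => // _ [z Sz <-]; apply: dU.
rewrite -[ball _ _ _]/(ball (set_val (ball_act g y)) d (set_val (ball_act g z))).
rewrite -ball_normE /= !val_ball_act.
set u := expand (set_val y); set w := expand (set_val z).
have small : `|act g u - act g w| <= d / 4 * `|act g u|.
  rewrite leNgt; apply/negP => big; apply: nF; exists u, w; split => //; exact: rP.
apply: le_lt_trans (contract_dist _ _) _.
have p : 0 < 1 + `|act g u| by rewrite ltr_pwDl.
rewrite mulrA ltr_pdivrMr //.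
have := mulr_ge0 (ltW d0) (normr_ge0 (act g u)); lra.
Qed.

Lemma ball_Z_structure : Z_structure (@ball_boundary n) ball_act.
Proof.
split; first exact: unit_ball_compact.
split; first exact: unit_ball_AR.
split; first exact: ball_boundary_Zset.
split; first exact: ball_act_action.
split; first exact: ball_act_proper.
split; first exact: ball_act_cocompact.
exact: ball_act_null.
Qed.

End BallAction.

Theorem mainTheorem3 (G : groupType) :
  finitely_generated G -> nilpotent G ->
  exists (Xbar : pseudoMetricType RR) (Z : set Xbar) (act : G -> Xbar -> Xbar),
    Z_structure Z act /\ exists n : nat, homeomorphic_sets Z (sphere n).
Proof.
move=> fgG nilG; have [n [act ctl]] := @euclidean_controlled RR G fgG nilG.
exists (@unit_ball RR n), (@ball_boundary n), (ball_act act).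
split; first exact: ball_Z_structure.
by exists n; exact: ball_boundary_sphere.
Qed.
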